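(* For every non-negative integer $n$: (1) $|\mathcal{SOR}_{1,n}|=n+1$; (2) $|\mathcal{SOR}_{2,n}|=n^4-2n^3+5n^2+1$; (3) $|\mathcal{SOR}_{3,n}|=n^9-15n^8+122n^7-604n^6+1973n^5-4201n^4+5640n^3-4240n^2+1347n+1$.
   Context: An $r\times r$ partial Latin rectangle based on $[n]=\{1,\ldots,n\}$ ($[0]=\emptyset$) is an $r\times r$ array in which each cell is either empty or contains a symbol of $[n]$, each symbol occurring at most once in each row and in each column. Two such arrays $P=(p_{ij}),Q=(q_{ij})$ are orthogonal if whenever $p_{ij}=p_{i'j'}\in[n]$ for distinct cells $(i,j)\neq(i',j')$, the entries $q_{ij}$ and $q_{i'j'}$ are not the same symbol of $[n]$. $P$ is self-orthogonal if it is orthogonal to its transpose. $\mathcal{SOR}_{r,n}$ denotes the set of self-orthogonal $r\times r$ partial Latin rectangles based on $[n]$. *)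

(* Defs.v *)
From mathcomp Require Import all_boot all_order all_algebra.

Set Implicit Arguments.
Unset Strict Implicit.
Unset Printing Implicit Defensive.

(* An array is a matrix over [option 'I_n]: [None] is an empty cell, and
   the symbols 1, ..., n are represented by the elements 0, ..., n-1 of 'I_n. *)

Definition same_symbol (n : nat) (x y : option 'I_n) : bool :=
  (x != None) && (x == y).

Definition partial_latin (r n : nat) (P : 'M[option 'I_n]_r) : bool :=
  [forall i, forall j, forall j', (j != j') ==> ~~ same_symbol (P i j) (P i j')]
  && [forall j, forall i, forall i',
        (i != i') ==> ~~ same_symbol (P i j) (P i' j)].

Definition plr_orthogonal (r n : nat) (P Q : 'M[option 'I_n]_r) : bool :=
  [forall i, forall j, forall i', forall j',
     ((i, j) != (i', j')) ==> same_symbol (P i j) (P i' j') ==>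
     ~~ same_symbol (Q i j) (Q i' j')].

Definition self_orthogonal (r n : nat) (P : 'M[option 'I_n]_r) : bool :=
  plr_orthogonal P P^T.

Definition SOR (r n : nat) : {set 'M[option 'I_n]_r} :=
  [set P | partial_latin P && self_orthogonal P].

(* Main.v *)
Require Import Defs.
From mathcomp Require Import all_boot all_order all_algebra.
From mathcomp Require Import ring.
Import GRing.Theory.
Set Implicit Arguments.
Unset Strict Implicit.
Local Open Scope ring_scope.

(** Self-orthogonality only depends on which cells are empty and which cells
    carry equal symbols.  Reading the array row by row and numbering the symbols
    in order of first occurrence, an array with exactly [k] distinct symbols
    becomes a canonical word, and every canonical word with [k] symbols arises
    from [n (n - 1) ... (n - k + 1)] arrays.  So the number of arrays is an
    integer combination of falling factorials of [n] whose coefficients are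
    found by enumerating the finitely many admissible canonical words. *)

(** * Words with empty letters: invariance under renaming and truncation *)

Section Words.
Local Open Scope nat_scope.

Definition same_filled (T : eqType) (x y : option T) : bool :=
  (x != None) && (x == y).

Lemma same_filled_omap (T U : eqType) (D : {pred T}) (g : T -> U)
    (x y : option T) :
    {in D &, injective g} -> oapp (mem D) true x -> oapp (mem D) true y ->
  same_filled (omap g x) (omap g y) = same_filled x y.
Proof.
move=> g_inj; case: x y => [x|] [y|] //= xD yD; rewrite /same_filled /=.
by apply/eqP/eqP => [[] /(g_inj _ _ xD yD) -> | [->]].
Qed.

(* The cell [(i, j)] is the letter of index [i * r + j]; letters beyond the end
   of the word are read as empty cells, so that prefixes can be tested too. *)
Definition cell (T : eqType) (r : nat) (w : seq (option T)) (c : nat * nat) :=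
  nth None w (c.1 * r + c.2).

(** Both Latin conditions and orthogonality to the transpose share the premise that two distinct
    cells hold the same symbol, so one implication carries all three. *)
Definition compatible (T : eqType) (r : nat) (w : seq (option T))
    (c d : nat * nat) : bool :=
  (c != d) ==> same_filled (cell r w c) (cell r w d) ==>
  [&& c.1 != d.1, c.2 != d.2
    & ~~ same_filled (cell r w (c.2, c.1)) (cell r w (d.2, d.1))].

Definition cells (r : nat) : seq (nat * nat) :=
  [seq (i, j) | i <- iota 0 r, j <- iota 0 r].

Definition sor_word (T : eqType) (r : nat) (w : seq (option T)) : bool :=
  all (fun c => all (compatible r w c) (cells r)) (cells r).

Lemma mem_cells (r : nat) (c : nat * nat) :
  (c \in cells r) = (c.1 < r) && (c.2 < r).
Proof.
case: c => i j; apply/allpairsP/andP => [[[i' j'] /= [hi hj [-> ->]]] | [hi hj]].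
  by move: hi hj; rewrite !mem_iota.
by exists (i, j); rewrite !mem_iota.
Qed.

Definition letters_in (T : eqType) (D : {pred T}) (w : seq (option T)) :=
  all (oapp (mem D) true) w.

Lemma cell_letters_in (T : eqType) (D : {pred T}) r (w : seq (option T)) c :
  letters_in D w -> oapp (mem D) true (cell r w c).
Proof.
move=> wD; rewrite /cell; case: (ltnP (c.1 * r + c.2) (size w)) => lt.
  exact: (all_nthP None wD).
by rewrite nth_default.
Qed.

(** Injectivity is asked only on [D] because the renaming applied later, [index^~ u], is injective
    only on [u]. *)
Lemma sor_word_map (T U : eqType) (D : {pred T}) (g : T -> U) r w :
    {in D &, injective g} -> letters_in D w ->
  sor_word r (map (omap g) w) = sor_word r w.
Proof.
move=> g_inj wD.
have cellE c : cell r (map (omap g) w) c = omap g (cell r w c).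
  rewrite /cell; case: (ltnP (c.1 * r + c.2) (size w)) => lt.
    by rewrite (nth_map None).
  by rewrite !nth_default ?size_map.
apply: eq_all => c; apply: eq_all => d; rewrite /compatible !cellE.
by rewrite !(same_filled_omap (D := D)) //; apply: cell_letters_in.
Qed.

(** Every violation consists of coincidences of symbols, and shortening a word creates none. This
    justifies pruning the search at a rejected prefix. *)
Lemma sor_word_prefix (T : eqType) r (w t : seq (option T)) :
  sor_word r (w ++ t) -> sor_word r w.
Proof.
have same_pre c d :
    same_filled (cell r w c) (cell r w d) ->
    same_filled (cell r (w ++ t) c) (cell r (w ++ t) d).
  rewrite /cell !nth_cat; case: ltnP => hc; last by rewrite nth_default.
  case: ltnP => // hd /andP[+ /eqP Ecd].
  by rewrite Ecd [nth None w (d.1 * _ + _)]nth_default.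
move=> /allP wt; apply/allP => c /wt /allP ct; apply/allP => d /ct.
rewrite /compatible => /implyP cd; apply/implyP => /cd /implyP sd.
apply/implyP => /same_pre /sd /and3P[-> ->] /=.
by apply: contra => /same_pre.
Qed.

End Words.

(** * Counting the completions of a prefix by falling factorials *)

Section Enumeration.
Local Open Scope nat_scope.

(* The numbers of distinct symbols of the admissible canonical words extending
   by [m] letters the word [w], whose symbols are [0, ..., k - 1]. *)
Fixpoint extensions (r m k : nat) (w : seq (option nat)) : seq nat :=
  if ~~ sor_word r w then [::] else
  if m is m'.+1 then
    extensions r m' k (rcons w None)
    ++ flatten [seq extensions r m' k (rcons w (Some i)) | i <- iota 0 k]
    ++ extensions r m' k.+1 (rcons w (Some k))
  else [:: k].

Lemma extensions_ge r m k w : all (leq k) (extensions r m k w).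
Proof.
elim: m k w => [|m IHm] k w /=; case: sor_word => //=; first by rewrite leqnn.
rewrite !all_cat IHm /=; apply/andP; split.
  by apply/allP => j /flatten_mapP[i _ /(allP (IHm _ _))].
by apply: sub_all (IHm k.+1 _) => j /ltnW.
Qed.

Lemma card_tupleS (T : finType) (m : nat) (P : pred (seq T)) :
  #|[pred t : m.+1.-tuple T | P t]|
  = \sum_(x : T) #|[pred t : m.-tuple T | P (x :: t)]|.
Proof.
under eq_bigr do rewrite -sum1_card big_mkcond /=.
rewrite -sum1_card big_mkcond pair_big /=.
have cons_bij : bijective (fun p : T * m.-tuple T => cons_tuple p.1 p.2).
  exists (fun t => (thead t, behead_tuple t)) => [[x t]|t] /=.
    by congr pair; apply: val_inj.
  by apply: val_inj; case/tupleP: t.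
by rewrite (reindex _ (onW_bij _ cons_bij)).
Qed.

Lemma sum_option (T : finType) (F : option T -> nat) :
  \sum_x F x = F None + \sum_x F (Some x).
Proof.
rewrite (bigD1 None) //=; congr (_ + _).
rewrite (reindex_omap Some id) => [|[] //].
by apply: eq_bigl => x; rewrite /= eqxx.
Qed.

Variables (n r : nat).
Implicit Types (s : seq (option 'I_n)) (u : seq 'I_n).

Definition pattern u s : seq (option nat) := map (omap (index^~ u)) s.

Lemma index_inj_in u : {in u &, injective (index^~ u)}.
Proof. by move=> x y xu yu /= E; rewrite -(nth_index x xu) E nth_index. Qed.

Lemma pattern_rcons_used u s x :
  letters_in (mem u) s -> pattern (rcons u x) s = pattern u s.
Proof.
move=> /allP su; apply/eq_in_map => -[y|] //= /su /= yu.
by rewrite -cats1 index_cat yu.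
Qed.

(** The factor [n ^_ (size u)] counts the choices of [u]; for a fixed pattern, each choice admits
    equally many completions. The induction sorts the next letter as empty, already in [u], or
    new. *)
Lemma card_extensions m u s : uniq u -> letters_in (mem u) s ->
  n ^_ (size u) * #|[pred t : m.-tuple (option 'I_n) | sor_word r (s ++ t)]|
  = \sum_(k <- extensions r m (size u) (pattern u s)) n ^_ k.
Proof.
elim: m u s => [|m IHm] u s u_uniq su.
  rewrite /= (sor_word_map (D := mem u) _ (@index_inj_in u)) //.
  rewrite (eq_card (B := [pred _ | sor_word r s])); last first.
    by move=> t; rewrite tuple0 !inE cats0.
  case: (sor_word r s); rewrite ?big_nil ?big_seq1 /=.
    by rewrite card_tuple muln1.
  by rewrite card0 muln0.
rewrite /= (sor_word_map (D := mem u) _ (@index_inj_in u)) //.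
have [s_ok|s_bad] := boolP (sor_word r s); last first.
  rewrite big_nil eq_card0 ?muln0 // => t; rewrite !inE.
  by apply: contraNF s_bad => /sor_word_prefix.
rewrite (card_tupleS _ (fun t => sor_word r (s ++ t))).
pose F x := #|[pred t : m.-tuple (option 'I_n) | sor_word r (rcons s x ++ t)]|.
rewrite (eq_bigr F); last first.
  by move=> x _; apply: eq_card => t; rewrite !inE cat_rcons.
have step v x : uniq v -> letters_in (mem v) (rcons s x) ->
    n ^_ (size v) * F x
    = \sum_(k <- extensions r m (size v) (pattern v (rcons s x))) n ^_ k.
  exact: IHm.
rewrite sum_option /= (bigID (mem u)) /= !mulnDr !big_cat /=.
congr (_ + (_ + _)).
- by rewrite step /pattern ?map_rcons // /letters_in all_rcons.
- rewrite -big_uniq // big_flatten /= big_map big_distrr /=.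
  have -> : iota 0 (size u) = [seq index x u | x <- u].
    apply: (@eq_from_nth _ 0); rewrite size_iota ?size_map // => i lt.
    have x0 : 'I_n by case: (u) lt.
    by rewrite nth_iota // (nth_map x0) // index_uniq.
  rewrite big_map; apply: eq_big_seq => x xu.
  by rewrite step /pattern ?map_rcons // /letters_in all_rcons /= xu.
(* All [n - size u] new symbols give the same canonical word, and this number is the factor that
   turns [n ^_ (size u)] into [n ^_ (size u).+1]. *)
- pose l := extensions r m (size u).+1 (rcons (pattern u s) (Some (size u))).
  have stepN x : x \notin u ->
      n ^_ (size u).+1 * F (Some x) = \sum_(k <- l) n ^_ k.
    move=> xNu; have := step (rcons u x) (Some x).
    rewrite size_rcons rcons_uniq xNu u_uniq /letters_in all_rcons /=.
    rewrite mem_rcons mem_head /= => -> //; last first.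
      apply: sub_all su => -[y|] //=; rewrite mem_rcons inE => ->.
      exact: orbT.
    have index_x : index x (rcons u x) = size u.
      by rewrite -cats1 index_cat (negPf xNu) /= eqxx addn0.
    rewrite [in LHS]/pattern map_rcons /= index_x.
    by rewrite -/(pattern _ _) pattern_rcons_used.
  have card_new : #|[predC u]| = n - size u.
    by rewrite -(card_uniqP u_uniq) -[n in n - _]card_ord -(cardC (mem u)) addKn.
  have [x0 x0Nu|all_used] := pickP [predC u].
    have ffact_gt0 : 0 < n ^_ (size u).+1.
      rewrite ffact_gt0 -subn_gt0 -card_new.
      by apply/card_gt0P; exists x0.
    rewrite -(stepN x0) // (eq_bigr (fun=> F (Some x0))) => [|x xNu].
      by rewrite sum_nat_const card_new ffactnSr mulnA.
    by apply/eqP; rewrite -(eqn_pmul2l ffact_gt0) !stepN.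
  (* Here [u] exhausts the symbols, so each [k] in [l] exceeds [n] and its falling factorial is
     0. *)
  rewrite big_pred0 // muln0 big_seq big1 // => k /(allP (extensions_ge _ _ _ _)) lt.
  by rewrite ffact_small // (leq_trans _ lt) // ltnS -subn_eq0 -card_new eq_card0.
Qed.

Lemma card_sor_words m :
  #|[pred t : m.-tuple (option 'I_n) | sor_word r t]|
  = \sum_(k <- extensions r m 0 [::]) n ^_ k.
Proof. by rewrite -(@card_extensions m [::] [::]) //= mul1n. Qed.

End Enumeration.

(** * Arrays as words of length [r * r] *)

Section Arrays.
Local Open Scope nat_scope.

Variables (n r : nat).

Definition array_of (w : seq (option 'I_n)) : 'M[option 'I_n]_r :=
  \matrix_(i, j) cell r w (val i, val j).

Lemma mem_SORP (P : 'M[option 'I_n]_r) :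
  reflect (forall i j i' j', (i, j) != (i', j') ->
             same_symbol (P i j) (P i' j') ->
           [&& i != i', j != j' & ~~ same_symbol (P j i) (P j' i')])
    (P \in SOR r n).
Proof.
rewrite inE; apply: (iffP andP) => [[/andP[row col] orth] i j i' j' neq same|ok].
  apply/and3P; split.
  - apply/eqP => Ei; subst i'; move: neq same; rewrite xpair_eqE eqxx /=.
    have /forallP/(_ i)/forallP/(_ j)/forallP/(_ j')/implyP ok := row.
    by move=> /ok/negP.
  - apply/eqP => Ej; subst j'; move: neq same; rewrite xpair_eqE eqxx andbT.
    have /forallP/(_ j)/forallP/(_ i)/forallP/(_ i')/implyP ok := col.
    by move=> /ok/negP.
  - have /forallP/(_ i)/forallP/(_ j)/forallP/(_ i')/forallP/(_ j') := orth.
    by rewrite neq same !mxE.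
split; last first.
  apply/forallP => i; apply/forallP => j; apply/forallP => i'; apply/forallP => j'.
  apply/implyP => neq; apply/implyP => same.
  by have /and3P[_ _] := ok _ _ _ _ neq same; rewrite !mxE.
apply/andP; split; apply/forallP => i; apply/forallP => j; apply/forallP => j';
  apply/implyP => neq; apply/negP => /ok.
  by rewrite !xpair_eqE !eqxx => /(_ neq).
by rewrite !xpair_eqE !eqxx andbT andbF => /(_ neq).
Qed.

Lemma sor_array_of (w : seq (option 'I_n)) :
  (array_of w \in SOR r n) = sor_word r w.
Proof.
apply/mem_SORP/allP => [ok [i j]|ok i j i' j' neq same].
  rewrite mem_cells => /andP[/= lti ltj]; apply/allP => -[i' j'].
  rewrite mem_cells => /andP[/= lti' ltj'].
  have := ok (Ordinal lti) (Ordinal ltj) (Ordinal lti') (Ordinal ltj').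
  rewrite !mxE => okw; apply/implyP => neq; apply/implyP => same.
  exact: okw neq same.
have c_in (a b : 'I_r) : (val a, val b) \in cells r by rewrite mem_cells !ltn_ord.
have /allP/(_ _ (c_in i' j'))/implyP := ok _ (c_in i j).
by move=> /(_ neq)/implyP; rewrite !mxE in same *; apply.
Qed.

Lemma array_of_bij :
  bijective (fun w : (r * r).-tuple (option 'I_n) => array_of w).
Proof.
apply: inj_card_bij; last by rewrite card_mx card_tuple.
move=> w w' E; apply: (@eq_from_tnth) => k.
have r_gt0 : 0 < r by case: (r) k => [[]|].
(* Letter [k] is recovered from row [k %/ r] and column [k %% r]. *)
have lt_div : k %/ r < r by rewrite ltn_divLR.
have /matrixP/(_ (Ordinal lt_div) (Ordinal (ltn_pmod k r_gt0))) := E.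
by rewrite !mxE /cell /= -divn_eq -!tnth_nth.
Qed.

Lemma card_SOR : #|SOR r n| = \sum_(k <- extensions r (r * r) 0 [::]) n ^_ k.
Proof.
rewrite -card_sor_words -!sum1_card (reindex _ (onW_bij _ array_of_bij)) /=.
by apply: eq_bigl => w; rewrite sor_array_of.
Qed.

End Arrays.

(** * From falling factorials to integer polynomials *)

Lemma natz_ffact (n k : nat) : (n ^_ k)%:Z = \prod_(i < k) (n%:Z - i%:Z).
Proof.
elim: k => [|k IHk]; first by rewrite ffactn0 big_ord0.
rewrite big_ord_recr /= -IHk ffactnSr PoszM; case: (leqP k n) => [le_kn|lt_nk].
  by rewrite subzn.
(* Truncated and integer subtraction differ here, but the preceding product is already 0. *)
by rewrite ffact_small // !mul0r.
Qed.

Lemma card_SOR_tally (n r : nat) :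
  #|SOR r n|%:Z = \sum_(b <- tally (extensions r (r * r) 0 [::]))
                    b.2%:Z * \prod_(i < b.1) (n%:Z - i%:Z).
Proof.
rewrite card_SOR -(perm_big _ (tallyK _)) big_flatten big_map /=.
rewrite -[LHS]natz natr_sum; apply: eq_bigr => -[k c] _ /=.
by rewrite big_nseq iter_addn_0 mulnC natrM !natz natz_ffact.
Qed.

Theorem theorem7 (n : nat) :
  [/\ #|SOR 1 n| = n.+1,
      #|SOR 2 n|%:Z = n%:Z ^+ 4 - 2 * n%:Z ^+ 3 + 5 * n%:Z ^+ 2 + 1
    & #|SOR 3 n|%:Z = n%:Z ^+ 9 - 15 * n%:Z ^+ 8 + 122 * n%:Z ^+ 7
        - 604 * n%:Z ^+ 6 + 1973 * n%:Z ^+ 5 - 4201 * n%:Z ^+ 4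
        + 5640 * n%:Z ^+ 3 - 4240 * n%:Z ^+ 2 + 1347 * n%:Z + 1].
Proof.
(* A pair [(k, c)] records that [c] admissible canonical words have exactly [k] symbols. *)
have tally2 : tally (extensions 2 (2 * 2) 0 [::])%N
    = [:: (0, 1); (1, 4); (2, 6); (3, 4); (4, 1)]%N.
  by vm_compute.
have tally3 : tally (extensions 3 (3 * 3) 0 [::])%N
    = [:: (0, 1); (1, 23); (2, 180); (3, 656); (4, 1224); (5, 1194);
          (6, 614); (7, 164); (8, 21); (9, 1)]%N.
  by vm_compute.
(* For [r = 1] the canonical words are the empty cell and one symbol, giving [1 + n]. *)
split; first by rewrite card_SOR big_cons big_seq1 ffactn0 ffactn1.
- rewrite card_SOR_tally tally2 !big_cons big_nil !big_ord_recr big_ord0 /=.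
  by ring.
- rewrite card_SOR_tally tally3 !big_cons big_nil !big_ord_recr big_ord0 /=.
  by ring.
Qed.
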